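(* For a non-degenerate Boolean restriction monoid $S$, let $S^{\downarrow}=[E(S)\mid \mathrm{Tot}(S)]$ be the matched pair of algebras formed by its Boolean algebra $E(S)$ of restriction idempotents and its monoid $\mathrm{Tot}(S)$ of total elements, with the structure described in the context. The assignment $S\mapsto S^{\downarrow}$ is the action on objects of an equivalence of categories $$(-)^{\downarrow}\colon \mathrm{br}\mathcal{M}on\longrightarrow[\mathcal{BA}lg\mid\mathcal{M}on]$$ from the category of (non-degenerate) Boolean restriction monoids to the category of (non-degenerate) matched pairs of algebras, which sends a homomorphism $\varphi\colon S\to T$ to the pair of restrictions $[\varphi|_{E(S)}\mid\varphi|_{\mathrm{Tot}(S)}]\colon S^{\downarrow}\to T^{\downarrow}$.
   Context: A restriction monoid is a monoid $S$ with a unary operation $s\mapsto s^+$ such that $s^+s=s$, $(s^+t)^+=s^+t^+$, $s^+t^+=t^+s^+$ and $st^+=(st)^+s$. Put $E(S)=\{s^+:s\in S\}=\{b : b^+=b\}$ (restriction idempotents) and $\mathrm{Tot}(S)=\{s: s^+=1\}$ (total elements, a submonoid). The order on $S$ is $s\leqslant t$ iff $s^+t=s$; $E(S)$ is a meet-semilattice with top $1$ and $b\wedge c=bc$. With $0$ the least element of $E(S)$, elements $s,t$ are disjoint if $s^+t^+=0$. A Boolean restriction monoid is a restriction monoid $S$ such that: $(E(S),\leqslant)$ is a Boolean algebra; the least element $0$ of $E(S)$ is a least element of $S$; every two disjoint $s,t\in S$ have a join $s\vee t$ for $\leqslant$; and $s0=0$, $s(t\vee u)=st\vee su$ for all $s,t,u$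 with $t,u$ disjoint. It is non-degenerate if $0\neq1$. A homomorphism is a monoid homomorphism preserving $(-)^+$, $0$ and joins of disjoint elements. $\mathrm{br}\mathcal{M}on$ is the resulting category (of non-degenerate Boolean restriction monoids). For a non-degenerate Boolean algebra $B$ ($0\ne1$, complement $b'$), a $B$-set is a set $X$ with an operation $B\times X\times X\to X$, $(b,x,y)\mapsto b(x,y)$, satisfying $b(x,x)=x$, $b(b(x,y),z)=b(x,z)$, $b(x,b(y,z))=b(x,z)$, $1(x,y)=x$, $b'(x,y)=b(y,x)$, $(b\wedge c)(x,y)=b(c(x,y),y)$. Write $x\equiv_b y$ iff $b(x,y)=y$; these are equivalence relations which determine the structure: $b(x,y)$ is the unique $z$ with $z\equiv_b x$ and $z\equiv_{b'}y$. A (non-degenerate) matched pair of algebras $[B\mid M]$ is a non-degenerate Boolean algebra $B$, a monoid $M$, a $B$-set structure on $M$, and a left action $(m,b)\mapsto m^*b$ of $M$ on $B$ by Boolean homomorphisms, such that for all $m,n,p\in M$, $b,c\in B$: $m\equiv_b n\Rightarrow mp\equiv_b np$; $n\equiv_b p\Rightarrow mn\equiv_{m^*b}mp$; $m\equiv_b n\Rightarrow b\wedge m^*c=b\wedge n^*c$. A homomorphism $[\varphi\mid f]\colon[B\mid M]\to[B'\mid M']$ is a Boolean homomorphism $\varphi\colon B\to B'$ and a monoid homomorphism $f\colon M\to M'$ with $m\equiv_bn\Rightarrow f(m)\equiv_{\varphi(b)}f(n)$ and $f(m)^*(\varphi(b))=\varphi(m^*b)$. $[\mathcal{BA}lg\mid\mathcal{M}on]$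 is the resulting category. In $S^{\downarrow}$ one takes $B=E(S)$, $M=\mathrm{Tot}(S)$, $m^*b=(mb)^+$, and $m\equiv_bn$ iff $bm=bn$. *)

(* Defs.v *)
From HB Require Import structures.
From mathcomp Require Import all_boot all_order.
From mathcomp Require Import boolp.

Set Implicit Arguments.
Unset Strict Implicit.
Unset Printing Implicit Defensive.

Import Order.Theory.
Set Warnings "-redundant-canonical-projection,-projection-no-head-constant".

Local Open Scope group_scope.
Local Open Scope order_scope.


(* Morphisms are compared with Leibniz equality, and [compose g f] is "g after f". *)
Record category := Category {
  obj :> Type;
  hom : obj -> obj -> Type;
  idm : forall x : obj, hom x x;
  compose : forall x y z : obj, hom y z -> hom x y -> hom x z;
  composeA : forall (x y z w : obj) (h : hom z w) (g : hom y z) (f : hom x y),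
    compose h (compose g f) = compose (compose h g) f;
  compose1m : forall (x y : obj) (f : hom x y), compose (idm y) f = f;
  composem1 : forall (x y : obj) (f : hom x y), compose f (idm x) = f
}.

Record functor (C D : category) := Functor {
  fobj :> C -> D;
  fmap : forall x y : C, hom x y -> hom (fobj x) (fobj y);
  fmap1 : forall x : C, fmap (idm x) = idm (fobj x);
  fmapM : forall (x y z : C) (g : hom y z) (f : hom x y),
    fmap (compose g f) = compose (fmap g) (fmap f)
}.

Definition functor_id (C : category) : functor C C :=
  @Functor C C (fun x => x) (fun _ _ f => f)
    (fun _ => erefl) (fun _ _ _ _ _ => erefl).

Fact functor_comp1 (C D E : category) (G : functor D E) (F : functor C D)
  (x : C) : fmap G (fmap F (idm x)) = idm (G (F x)).
Proof. by rewrite !fmap1. Qed.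

Fact functor_compM (C D E : category) (G : functor D E) (F : functor C D)
  (x y z : C) (g : hom y z) (f : hom x y) :
  fmap G (fmap F (compose g f)) = compose (fmap G (fmap F g)) (fmap G (fmap F f)).
Proof. by rewrite !fmapM. Qed.

Definition functor_comp (C D E : category) (G : functor D E) (F : functor C D) :
    functor C E :=
  @Functor C E (fun x => G (F x)) (fun _ _ f => fmap G (fmap F f))
    (functor_comp1 G F) (@functor_compM C D E G F).

Record nat_iso (C D : category) (F G : functor C D) := NatIso {
  nat_fwd : forall x : C, hom (F x) (G x);
  nat_bwd : forall x : C, hom (G x) (F x);
  nat_fwdP : forall (x y : C) (f : hom x y),
    compose (nat_fwd y) (fmap F f) = compose (fmap G f) (nat_fwd x);
  nat_fwdK : forall x : C, compose (nat_bwd x) (nat_fwd x) = idm (F x);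
  nat_bwdK : forall x : C, compose (nat_fwd x) (nat_bwd x) = idm (G x)
}.

Definition is_equivalence (C D : category) (F : functor C D) : Prop :=
  exists G : functor D C,
    inhabited (nat_iso (functor_id C) (functor_comp G F)) /\
    inhabited (nat_iso (functor_comp F G) (functor_id D)).


(* Displays are phantom parameters; one is fixed for all Boolean algebras. *)
Fact boolalg_display : Order.disp_t. Proof. exact: Order.Disp tt tt. Qed.

Notation boolAlgType := (ctbDistrLatticeType boolalg_display).

Record boolean_hom (B B' : boolAlgType) (f : B -> B') : Prop := BooleanHom {
  boolean_homI : Order.meet_morphism f;
  boolean_homU : Order.join_morphism f;
  boolean_hom0 : f \bot = \bot;
  boolean_hom1 : f \top = \top;
  boolean_homC : {morph f : x / ~` x}
}.

(* The poset T "is a Boolean algebra": it is, up to an isomorphism of posets, *)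
(* the underlying poset of a Boolean algebra.                                 *)
Definition boolean_poset (T : porderType boolalg_display) : Prop :=
  exists (B : boolAlgType) (f : T -> B),
    bijective f /\ {mono f : x y / x <= y}.


HB.mixin Record Monoid_isRestriction S of Monoid S := {
  rplus : S -> S;
  mulrplus : forall s : S, rplus s * s = s;
  rplusM : forall s t : S, rplus (rplus s * t) = rplus s * rplus t;
  rplusC : forall s t : S, rplus s * rplus t = rplus t * rplus s;
  mulgplus : forall s t : S, s * rplus t = rplus (s * t) * s
}.

#[short(type="restrictionMonoidType")]
HB.structure Definition RestrictionMonoid :=
  { S of Monoid S & Monoid_isRestriction S }.

Section RestrictionMonoidTheory.
Variable S : restrictionMonoidType.
Implicit Types s t u : S.

Definition rle s t : bool := rplus s * t == s.

Definition is_join s t u : Prop :=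
  [/\ rle s u, rle t u & forall v, rle s v -> rle t v -> rle u v].

Lemma rplus1 : rplus (1 : S) = 1.
Proof. by rewrite -[LHS]mulg1 mulrplus. Qed.

Lemma rplus_mulr s t : rplus (s * rplus t) = rplus (s * t).
Proof. by rewrite mulgplus rplusM rplusC -rplusM mulgA mulrplus. Qed.

Lemma rplusK s : rplus (rplus s) = rplus s.
Proof. by rewrite -[in LHS](mulg1 (rplus s)) rplusM rplus1 mulg1. Qed.

Lemma rplus_idem s : rplus s * rplus s = rplus s.
Proof. by rewrite -rplusM mulrplus. Qed.

Lemma rleP s t : reflect (rplus s * t = s) (rle s t).
Proof. exact: eqP. Qed.

Lemma rle_refl s : rle s s.
Proof. by apply/rleP; rewrite mulrplus. Qed.

Lemma rle_trans s t u : rle s t -> rle t u -> rle s u.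
Proof.
move=> /rleP st /rleP tu; apply/rleP.
by rewrite -[RHS]st -[X in _ = _ * X]tu mulgA -rplusM st.
Qed.

Lemma rle_anti s t : rle s t -> rle t s -> s = t.
Proof.
move=> /rleP st /rleP ts.
have: s = rplus s * (rplus t * s) by rewrite ts st.
by rewrite mulgA rplusC -mulgA mulrplus ts.
Qed.

Lemma rle_plus s t : rle s t -> rplus s * rplus t = rplus s.
Proof. by move=> /rleP st; rewrite -rplusM st. Qed.

Lemma rle1 s : rle s 1 = (rplus s == s).
Proof. by rewrite /rle mulg1. Qed.

Lemma tot_monoid_closed : monoid_closed [pred s : S | rplus s == 1].
Proof.
split=> [|s t]; rewrite !inE ?rplus1// => /eqP s1 /eqP t1.
by rewrite -rplus_mulr t1 mulg1 s1.
Qed.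

End RestrictionMonoidTheory.

(* [rplus s] is s^+; [ridem S] is E(S) and [tot S] is Tot(S). *)
Record ridem (S : restrictionMonoidType) :=
  RIdem { ridem_val : S; _ : rplus ridem_val == ridem_val }.
HB.instance Definition _ (S : restrictionMonoidType) :=
  [isSub for @ridem_val S].
HB.instance Definition _ (S : restrictionMonoidType) :=
  [Choice of ridem S by <:].

Record tot (S : restrictionMonoidType) :=
  Tot { tot_val : S; _ : rplus tot_val == 1 }.
HB.instance Definition _ (S : restrictionMonoidType) :=
  [isSub for @tot_val S].
HB.instance Definition _ (S : restrictionMonoidType) :=
  [Choice of tot S by <:].
HB.instance Definition _ (S : restrictionMonoidType) :=
  SubChoice_isSubMonoid.Build S _ (tot S) (tot_monoid_closed S).

Section Idempotents.
Variable S : restrictionMonoidType.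
Implicit Types (b c : ridem S) (s t : S) (m : tot S).

Lemma ridemP b : rplus (\val b) = \val b.
Proof. by case: b => b /= /eqP. Qed.

Lemma totP m : rplus (\val m) = 1.
Proof. by case: m => m /= /eqP. Qed.

Lemma ridem_valM b c : rplus (\val b * \val c) == \val b * \val c.
Proof. by rewrite -{1}(ridemP b) rplusM !ridemP. Qed.

Definition ridem_plus s : ridem S := RIdem (introT eqP (rplusK s)).
Definition ridem1 : ridem S := RIdem (introT eqP (rplus1 S)).
Definition ridemI b c : ridem S := RIdem (ridem_valM b c).

Lemma ridemC b c : \val b * \val c = \val c * \val b.
Proof. by rewrite -(ridemP b) -(ridemP c) rplusC. Qed.

Lemma ridem_idem b : \val b * \val b = \val b.
Proof. by rewrite -(ridemP b) rplus_idem. Qed.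

Definition ridem_le b c : bool := rle (\val b) (\val c).

Fact ridem_le_refl : reflexive ridem_le.
Proof. by move=> b; exact: rle_refl. Qed.

Fact ridem_le_anti : antisymmetric ridem_le.
Proof. by move=> b c /andP[bc cb]; apply/val_inj/rle_anti. Qed.

Fact ridem_le_trans : transitive ridem_le.
Proof. by move=> c b d; exact: rle_trans. Qed.

HB.instance Definition _ := Order.Le_isPOrder.Build boolalg_display (ridem S)
  ridem_le_refl ridem_le_anti ridem_le_trans.

Lemma ridem_leE b c : (b <= c) = (\val b * \val c == \val b).
Proof. by rewrite -[RHS]/(_ == _) -{1}(ridemP b). Qed.

Fact ridem_lexI b c d : (b <= ridemI c d) = (b <= c) && (b <= d).
Proof.
rewrite !ridem_leE -[\val (ridemI c d)]/(\val c * \val d).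
apply/eqP/andP => [bcd|[/eqP bc /eqP bd]]; last by rewrite mulgA bc bd.
have dd : \val b * (\val c * \val d) * \val d = \val b * (\val c * \val d).
  by rewrite -!mulgA ridem_idem.
have cc : \val b * (\val c * \val d) * \val c = \val b * (\val c * \val d).
  by rewrite (ridemC c) -!mulgA ridem_idem.
by move: cc dd; rewrite bcd => -> ->.
Qed.

Fact ridem_lex1 b : b <= ridem1.
Proof. by rewrite ridem_leE mulg1. Qed.

End Idempotents.

(* Joins are given by their universal property [is_join], as they need not
   exist for non-disjoint elements.  As [rle] restricts to the order of E(S),
   [rzero_rle] contains the fact that 0 is the least element of E(S). *)
HB.mixin Record RestrictionMonoid_isBoolean S of RestrictionMonoid S := {
  ridem_boolean : boolean_poset (ridem S);
  rzero : ridem S;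
  rzero_rle : forall s : S, rle (\val rzero) s;
  disjoint_join : forall s t : S, rplus s * rplus t = \val rzero ->
    exists u : S, is_join s t u;
  mulg_rzero : forall s : S, s * \val rzero = \val rzero;
  mulg_join : forall s t u v : S, rplus t * rplus u = \val rzero ->
    is_join t u v -> is_join (s * t) (s * u) (s * v)
}.

#[short(type="booleanRestrictionMonoidType")]
HB.structure Definition BooleanRestrictionMonoid :=
  { S of RestrictionMonoid S & RestrictionMonoid_isBoolean S }.

Definition rdisjoint (S : booleanRestrictionMonoidType) (s t : S) : Prop :=
  rplus s * rplus t = \val rzero.


Section IdempotentsBoolean.
Variable S : booleanRestrictionMonoidType.
Implicit Types (b c : ridem S) (s t : S).

Lemma rzero_le b : rzero <= b.
Proof. exact: rzero_rle. Qed.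

Lemma ridem_join_compl :
  exists JC : (ridem S -> ridem S -> ridem S) * (ridem S -> ridem S),
  [/\ forall b c d, (JC.1 b c <= d) = (b <= d) && (c <= d),
      left_distributive (@ridemI S) JC.1,
      forall b, JC.1 b (JC.2 b) = ridem1 S
    & forall b, ridemI b (JC.2 b) = rzero].
Proof.
have [B [f [[g fK gK] fle]]] := ridem_boolean (s := S).
have gle x y : (g x <= g y) = (x <= y) by rewrite -fle !gK.
have fI b c : f (ridemI b c) = f b `&` f c.
  apply/le_anti/andP; split.
    have := lexx (ridemI b c); rewrite ridem_lexI => /andP[h1 h2].
    by rewrite lexI !fle h1 h2.
  by rewrite -{1}[X in X <= _]gK fle ridem_lexI -!fle gK leIl leIr.
have f1 : f (ridem1 S) = \top.
  by apply/le_anti; rewrite lex1 -[X in X <= _]gK fle ridem_lex1.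
have f0 : f rzero = \bot.
  by apply/le_anti; rewrite le0x -[X in _ <= X]gK fle rzero_le.
exists (fun b c => g (f b `|` f c), fun b => g (~` f b)) => /=; split.
- by move=> b c d; rewrite -fle gK leUx !fle.
- by move=> b c d; apply: (can_inj fK); rewrite fI !gK !fI meetUl.
- by move=> b; apply: (can_inj fK); rewrite !gK joinxC f1.
- by move=> b; apply: (can_inj fK); rewrite fI !gK meetxC f0.
Qed.

Definition ridemU b c : ridem S := (sval (cid ridem_join_compl)).1 b c.
Definition ridemN b : ridem S := (sval (cid ridem_join_compl)).2 b.

Fact ridem_leUx b c d : (ridemU b c <= d) = (b <= d) && (c <= d).
Proof. by rewrite /ridemU; case: cid => JC [] /=. Qed.

HB.instance Definition _ :=
  Order.POrder_MeetJoin_isLattice.Build boolalg_display (ridem S)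
    (@ridem_lexI S) ridem_leUx.

Fact ridem_meetUl : left_distributive (@Order.meet _ (ridem S)) Order.join.
Proof.
by move=> b c d; rewrite /Order.meet/= /Order.join/= /ridemU; case: cid => JC [].
Qed.

HB.instance Definition _ :=
  Order.Lattice_Meet_isDistrLattice.Build boolalg_display (ridem S) ridem_meetUl.
HB.instance Definition _ :=
  Order.hasBottom.Build boolalg_display (ridem S) rzero_le.
HB.instance Definition _ :=
  Order.hasTop.Build boolalg_display (ridem S) (@ridem_lex1 S).

Fact ridem_joinxC b : b `|` ridemN b = \top.
Proof. by rewrite /Order.join/= /ridemU /ridemN; case: cid => JC []. Qed.

Fact ridem_meetxC b : b `&` ridemN b = \bot.
Proof. by rewrite /Order.meet/= /ridemN; case: cid => JC []. Qed.

HB.instance Definition _ :=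
  Order.TBDistrLattice_hasComplement.Build boolalg_display (ridem S)
    ridem_joinxC ridem_meetxC.

Lemma ridem_meetE b c : \val (b `&` c) = \val b * \val c. Proof. by []. Qed.
Lemma ridem_botE : (\bot : ridem S) = rzero. Proof. by []. Qed.
Lemma ridem_topE : \val (\top : ridem S) = 1. Proof. by []. Qed.

End IdempotentsBoolean.


Record brmon := BRMon {
  brmon_sort :> booleanRestrictionMonoidType;
  brmon_nondeg : \val (rzero : ridem brmon_sort) <> 1
}.

Record br_hom (S T : booleanRestrictionMonoidType) (f : S -> T) : Prop :=
  BRHom {
    br_hom_monoid : monoid_morphism f;
    br_hom_plus : {morph f : s / rplus s};
    br_hom_zero : f (\val rzero) = \val rzero;
    br_hom_join : forall s t u : S, rdisjoint s t ->
      is_join s t u -> is_join (f s) (f t) (f u)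
  }.

Fact br_hom_id (S : booleanRestrictionMonoidType) : br_hom (fun s : S => s).
Proof. by split. Qed.

Lemma br_hom_disjoint (S T : booleanRestrictionMonoidType) (f : S -> T) s t :
  br_hom f -> rdisjoint s t -> rdisjoint (f s) (f t).
Proof.
by case=> -[_ fM] fp f0 _ st; rewrite /rdisjoint -!fp -fM st f0.
Qed.

Fact br_hom_comp (S T U : booleanRestrictionMonoidType) (g : T -> U)
  (f : S -> T) : br_hom g -> br_hom f -> br_hom (fun s => g (f s)).
Proof.
move=> hg hf; have [[g1 gM] gp g0 gU] := hg; have [[f1 fM] fp f0 fU] := hf.
split.
- by split=> [|s t]; rewrite ?f1 ?fM.
- by move=> s; rewrite fp gp.
- by rewrite f0 g0.
- by move=> s t u st /(fU _ _ _ st); apply: gU; exact: br_hom_disjoint.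
Qed.

Definition br_Hom (S T : brmon) : Type := {f : S -> T | br_hom f}.

Lemma br_Hom_eq (S T : brmon) (f g : br_Hom S T) : sval f =1 sval g -> f = g.
Proof. by case: f g => [f hf] [g hg] /= /funext; exact: eq_exist. Qed.

Definition br_idm (S : brmon) : br_Hom S S := exist _ _ (br_hom_id S).

Definition br_compose (S T U : brmon) (g : br_Hom T U) (f : br_Hom S T) :
    br_Hom S U :=
  exist _ (fun s => sval g (sval f s)) (br_hom_comp (svalP g) (svalP f)).

Fact br_composeA (S T U V : brmon) (h : br_Hom U V) (g : br_Hom T U)
  (f : br_Hom S T) :
  br_compose h (br_compose g f) = br_compose (br_compose h g) f.
Proof. exact: br_Hom_eq. Qed.

Fact br_compose1m (S T : brmon) (f : br_Hom S T) : br_compose (br_idm T) f = f.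
Proof. exact: br_Hom_eq. Qed.

Fact br_composem1 (S T : brmon) (f : br_Hom S T) : br_compose f (br_idm S) = f.
Proof. exact: br_Hom_eq. Qed.

Definition brMon : category :=
  Category br_composeA br_compose1m br_composem1.


Record is_bset (B : boolAlgType) (X : Type) (op : B -> X -> X -> X) : Prop :=
  IsBSet {
    bset_xx : forall b x, op b x x = x;
    bset_opl : forall b x y z, op b (op b x y) z = op b x z;
    bset_opr : forall b x y z, op b x (op b y z) = op b x z;
    bset_top : forall x y, op \top x y = x;
    bset_compl : forall b x y, op (~` b) x y = op b y x;
    bset_meet : forall b c x y, op (b `&` c) x y = op b (op c x y) y
  }.

Definition bset_equiv (B X : Type) (op : B -> X -> X -> X) (b : B) (x y : X) :
  Prop := op b x y = y.

Record matched_pair := MatchedPair {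
  mpB : boolAlgType;
  mpM : monoidType;
  mp_op : mpB -> mpM -> mpM -> mpM;
  mp_act : mpM -> mpB -> mpB;
  mp_nondeg : (\bot : mpB) <> \top;
  mp_bset : is_bset mp_op;
  mp_act1 : forall b : mpB, mp_act 1 b = b;
  mp_actM : forall (m n : mpM) (b : mpB),
    mp_act (m * n) b = mp_act m (mp_act n b);
  mp_act_hom : forall m : mpM, boolean_hom (mp_act m);
  mp_equiv_mulr : forall (m n p : mpM) (b : mpB),
    bset_equiv mp_op b m n -> bset_equiv mp_op b (m * p) (n * p);
  mp_equiv_mull : forall (m n p : mpM) (b : mpB),
    bset_equiv mp_op b n p -> bset_equiv mp_op (mp_act m b) (m * n) (m * p);
  mp_equiv_act : forall (m n : mpM) (b c : mpB),
    bset_equiv mp_op b m n -> b `&` mp_act m c = b `&` mp_act n c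
}.

Record mp_hom (P Q : matched_pair) (phi : mpB P -> mpB Q) (f : mpM P -> mpM Q) :
  Prop := MPHom {
    mp_hom_boolean : boolean_hom phi;
    mp_hom_monoid : monoid_morphism f;
    mp_hom_equiv : forall (b : mpB P) (m n : mpM P),
      bset_equiv (@mp_op P) b m n -> bset_equiv (@mp_op Q) (phi b) (f m) (f n);
    mp_hom_act : forall (m : mpM P) (b : mpB P),
      mp_act (f m) (phi b) = phi (mp_act m b)
  }.

Fact mp_hom_id (P : matched_pair) :
  mp_hom (fun b : mpB P => b) (fun m : mpM P => m).
Proof. by []. Qed.

Fact mp_hom_comp (P Q R : matched_pair)
  (psi : mpB Q -> mpB R) (g : mpM Q -> mpM R)
  (phi : mpB P -> mpB Q) (f : mpM P -> mpM Q) :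
  mp_hom psi g -> mp_hom phi f ->
  mp_hom (fun b => psi (phi b)) (fun m => g (f m)).
Proof.
case=> -[psiI psiU psi0 psi1 psiC] [g1 gM] ge ga.
case=> -[phiI phiU phi0 phi1 phiC] [f1 fM] fe fa.
split=> [|||m b]; last by rewrite ga fa.
- split=> [b c|b c|||b].
  + by rewrite phiI psiI.
  + by rewrite phiU psiU.
  + by rewrite phi0 psi0.
  + by rewrite phi1 psi1.
  + by rewrite phiC psiC.
- by split=> [|m n]; rewrite ?f1 ?fM.
- by move=> b m n /fe; exact: ge.
Qed.

Definition mp_Hom (P Q : matched_pair) : Type :=
  {h : (mpB P -> mpB Q) * (mpM P -> mpM Q) | mp_hom h.1 h.2}.

Lemma mp_Hom_eq (P Q : matched_pair) (h k : mp_Hom P Q) :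
  (sval h).1 =1 (sval k).1 -> (sval h).2 =1 (sval k).2 -> h = k.
Proof.
case: h k => [[h1 h2] hh] [[k1 k2] hk] /= /funext e1 /funext e2.
by apply: eq_exist; rewrite e1 e2.
Qed.

Definition mp_idm (P : matched_pair) : mp_Hom P P :=
  exist _ (fun b => b, fun m => m) (mp_hom_id P).

Definition mp_compose (P Q R : matched_pair) (k : mp_Hom Q R)
    (h : mp_Hom P Q) : mp_Hom P R :=
  exist _ (fun b => (sval k).1 ((sval h).1 b),
           fun m => (sval k).2 ((sval h).2 m))
    (mp_hom_comp (svalP k) (svalP h)).

Fact mp_composeA (P Q R T : matched_pair) (l : mp_Hom R T) (k : mp_Hom Q R)
  (h : mp_Hom P Q) :
  mp_compose l (mp_compose k h) = mp_compose (mp_compose l k) h.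
Proof. exact: mp_Hom_eq. Qed.

Fact mp_compose1m (P Q : matched_pair) (h : mp_Hom P Q) :
  mp_compose (mp_idm Q) h = h.
Proof. exact: mp_Hom_eq. Qed.

Fact mp_composem1 (P Q : matched_pair) (h : mp_Hom P Q) :
  mp_compose h (mp_idm P) = h.
Proof. exact: mp_Hom_eq. Qed.

Definition matchedPairs : category :=
  Category mp_composeA mp_compose1m mp_composem1.


Lemma boolean_hom_of_compl (B B' : boolAlgType) (f : B -> B') :
  {morph f : x y / x `&` y} -> f \bot = \bot -> f \top = \top ->
  (forall x, f x `|` f (~` x) = \top) -> boolean_hom f.
Proof.
move=> fI f0 f1 fxC.
have fC x : f (~` x) = ~` f x.
  apply/le_anti/andP; split.
    by rewrite -disj_leC -fI meetCx f0.
  by rewrite -[X in X <= _]meetx1 -(fxC x) meetUr meetCx join0x leIr.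
split=> // x y.
by rewrite -[x `|` y]complK complU fC fI !fC complI !complK.
Qed.

Section DownObject.
Variable S : booleanRestrictionMonoidType.
Implicit Types (b c : ridem S) (s t : S) (m n p : tot S).

Lemma rplus_ridemM b s : rplus (\val b * s) = \val (b `&` ridem_plus s).
Proof. by rewrite -{1}(ridemP b) rplusM ridemP. Qed.

Lemma ridem_compl_disjoint b s t :
  rdisjoint (\val b * s) (\val (~` b) * t).
Proof.
rewrite /rdisjoint !rplus_ridemM -ridem_meetE meetACA meetxC meet0x.
by rewrite ridem_botE.
Qed.

Lemma rle_ridemMl b s : rle (\val b * s) s.
Proof.
by apply/rleP; rewrite rplus_ridemM ridem_meetE -mulgA /= mulrplus.
Qed.

Lemma is_join_uniq s t u v : is_join s t u -> is_join s t v -> u = v.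
Proof.
move=> [su tu u_min] [sv tv v_min].
by apply: rle_anti; [exact: u_min|exact: v_min].
Qed.

Lemma is_join_compl b s : is_join (\val b * s) (\val (~` b) * s) s.
Proof.
have [j js] := disjoint_join _ _ (ridem_compl_disjoint b s s).
have [bj b'j j_min] := js; suff jE : j = s by rewrite jE in js.
have jles := j_min _ (rle_ridemMl b s) (rle_ridemMl _ s).
have : ridem_plus s <= ridem_plus j.
  have le c : rle (\val c * s) j -> c `&` ridem_plus s <= ridem_plus j.
    move=> /rle_plus cj; rewrite ridem_leE -rplus_ridemM.
    by apply/eqP; exact: cj.
  by rewrite -[X in X <= _]meet1x -(joinxC b) meetUl leUx !le.
rewrite ridem_leE /= => /eqP sj; move/rleP: jles => <-.
by rewrite -[in LHS](mulrplus s) mulgA rplusC sj mulrplus.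
Qed.

Lemma ridem_sep b s t :
  \val b * s = \val b * t -> \val (~` b) * s = \val (~` b) * t -> s = t.
Proof.
move=> bst b'st; apply: is_join_uniq (is_join_compl b s) _.
by rewrite bst b'st; exact: is_join_compl.
Qed.

Lemma tot_glue b m n : exists z : tot S,
  \val b * \val z = \val b * \val m /\
  \val (~` b) * \val z = \val (~` b) * \val n.
Proof.
have [j [bj b'j _]] :=
  disjoint_join _ _ (ridem_compl_disjoint b (\val m) (\val n)).
have plus_tot c (q : tot S) : rplus (\val c * \val q) = \val c.
  by rewrite rplus_ridemM /= totP mulg1.
have j1 : rplus j == 1.
  have : \top <= ridem_plus j.
    rewrite -(joinxC b) leUx !ridem_leE /=.
    move: (rle_plus bj) (rle_plus b'j); rewrite !plus_tot => -> ->.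
    by rewrite !eqxx.
  by rewrite ridem_leE ridem_topE mul1g.
exists (Tot j1) => /=; move/rleP: bj; move/rleP: b'j.
by rewrite !plus_tot.
Qed.

(* b(m,n) is the unique z in Tot(S) with bz = bm and b'z = b'n; uniqueness is *)
(* [tot_sep], and [tot_caseE] below says that the relations m =_b n it        *)
(* induces are bm = bn.                                                       *)
Definition tot_case b m n : tot S := sval (cid (tot_glue b m n)).

Definition tot_act m b : ridem S := ridem_plus (\val m * \val b).

Lemma tot_case1 b m n : \val b * \val (tot_case b m n) = \val b * \val m.
Proof. by rewrite /tot_case; case: cid => z []. Qed.

Lemma tot_case2 b m n :
  \val (~` b) * \val (tot_case b m n) = \val (~` b) * \val n.
Proof. by rewrite /tot_case; case: cid => z []. Qed.

Lemma tot_sep b m n :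
  \val b * \val m = \val b * \val n ->
  \val (~` b) * \val m = \val (~` b) * \val n -> m = n.
Proof. by move=> bmn b'mn; apply/val_inj/(ridem_sep bmn b'mn). Qed.

Lemma tot_caseE b m n :
  bset_equiv tot_case b m n <-> \val b * \val m = \val b * \val n.
Proof.
rewrite /bset_equiv; split=> [<-|bmn]; first by rewrite tot_case1.
by apply: (@tot_sep b); rewrite ?tot_case1 ?tot_case2.
Qed.

Fact tot_case_bset : is_bset tot_case.
Proof.
split.
- by move=> b x; apply: (@tot_sep b); rewrite ?tot_case1 ?tot_case2.
- by move=> b x y z; apply: (@tot_sep b); rewrite ?tot_case1 ?tot_case2.
- by move=> b x y z; apply: (@tot_sep b); rewrite ?tot_case1 ?tot_case2.
- move=> x y; have := tot_case1 \top x y.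
  by rewrite ridem_topE !mul1g => /val_inj.
- move=> b x y; apply: (@tot_sep b); last by rewrite tot_case2 tot_case1.
  by have := tot_case2 (~` b) x y; rewrite complK tot_case1.
- move=> b c x y; apply: (@tot_sep (b `&` c)).
    rewrite tot_case1 !ridem_meetE (ridemC b) -!mulgA tot_case1.
    by rewrite !mulgA (ridemC c) -!mulgA tot_case1.
  rewrite tot_case2; apply: (@ridem_sep b); rewrite !mulgA.
    have -> : \val b * \val (~` (b `&` c)) = \val b * \val (~` c).
      by rewrite -!ridem_meetE complI meetUr meetxC join0x.
    rewrite (ridemC b) -!mulgA tot_case1 !mulgA (ridemC _ b) -!mulgA.
    by rewrite tot_case2.
  rewrite (ridemC (~` b)) -!mulgA; congr (_ * _).
  by rewrite tot_case2.
Qed.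

Lemma tot_act_mul m b : \val (tot_act m b) * \val m = \val m * \val b.
Proof. by rewrite /= -mulgplus ridemP. Qed.

Fact tot_act1 b : tot_act 1 b = b.
Proof. by apply: val_inj; rewrite -[LHS]/(rplus (\val 1 * \val b)) val1 mul1g ridemP. Qed.

Fact tot_actM m n b : tot_act (m * n) b = tot_act m (tot_act n b).
Proof.
apply: val_inj; rewrite -[LHS]/(rplus (\val (m * n) * \val b)) valM.
by rewrite -mulgA -rplus_mulr.
Qed.

Fact tot_act_hom m : boolean_hom (tot_act m).
Proof.
apply: boolean_hom_of_compl => [b c|||b].
- apply: val_inj; rewrite -[LHS]/(rplus (\val m * (\val b * \val c))).
  rewrite -[RHS]/(rplus (\val m * \val b) * rplus (\val m * \val c)).
  by rewrite -rplusM !mulgA -mulgplus ridemP.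
- by apply: val_inj; rewrite /= mulg_rzero ridemP.
- by apply: val_inj; rewrite /= mulg1 totP.
- set e := _ `|` _.
  have le c : tot_act m c <= e -> rle (\val m * \val c) (\val e * \val m).
    rewrite ridem_leE => /eqP ce; apply/rleP.
    by rewrite mulgA -[rplus _]/(\val (tot_act m c)) ce tot_act_mul.
  have /mulg_join : rdisjoint (\val b) (\val (~` b)).
    by rewrite /rdisjoint !ridemP -ridem_meetE meetxC.
  have := is_join_compl b 1; rewrite !mulg1 => j1 /(_ (\val m) _ j1) [_ _].
  move=> /(_ (\val e * \val m)); rewrite mulg1.
  move=> /(_ (le _ (leUl _ _)) (le _ (leUr _ _))) /rleP.
  rewrite totP mul1g => em; apply: val_inj.
  by have := rplus_ridemM e (\val m); rewrite em ridem_meetE /= totP mulg1.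
Qed.

Fact tot_equiv_mulr m n p b :
  bset_equiv tot_case b m n -> bset_equiv tot_case b (m * p) (n * p).
Proof. by rewrite !tot_caseE !valM !mulgA => ->. Qed.

Fact tot_equiv_mull m n p b :
  bset_equiv tot_case b n p -> bset_equiv tot_case (tot_act m b) (m * n) (m * p).
Proof.
by rewrite !tot_caseE !valM !mulgA !tot_act_mul -!mulgA => ->.
Qed.

Fact tot_equiv_act m n b c : bset_equiv tot_case b m n ->
  b `&` tot_act m c = b `&` tot_act n c.
Proof.
rewrite tot_caseE => bmn.
by apply: val_inj; rewrite -!rplus_ridemM !mulgA bmn.
Qed.

End DownObject.

Fact down_nondeg (S : brmon) : (\bot : ridem S) <> \top.
Proof. by move=> /(congr1 val); exact: brmon_nondeg. Qed.

Definition down (S : brmon) : matched_pair :=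
  @MatchedPair (ridem S) (tot S) (@tot_case S) (@tot_act S)
    (@down_nondeg S) (tot_case_bset S) (@tot_act1 S) (@tot_actM S)
    (@tot_act_hom S) (@tot_equiv_mulr S) (@tot_equiv_mull S)
    (@tot_equiv_act S).

Fact br_hom_ridem (S T : booleanRestrictionMonoidType) (f : S -> T) :
  br_hom f -> forall b : ridem S, rplus (f (\val b)) == f (\val b).
Proof. by case=> _ fp _ _ b; rewrite -fp ridemP. Qed.

Fact br_hom_tot (S T : booleanRestrictionMonoidType) (f : S -> T) :
  br_hom f -> forall m : tot S, rplus (f (\val m)) == 1.
Proof. by case=> -[f1 _] fp _ _ m; rewrite -fp totP f1. Qed.

Definition ridem_restr (S T : booleanRestrictionMonoidType) (f : S -> T)
  (hf : br_hom f) (b : ridem S) : ridem T := RIdem (br_hom_ridem hf b).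

Definition tot_restr (S T : booleanRestrictionMonoidType) (f : S -> T)
  (hf : br_hom f) (m : tot S) : tot T := Tot (br_hom_tot hf m).

Fact down_restr_hom (S T : brmon) (f : S -> T) (hf : br_hom f) :
  @mp_hom (down S) (down T) (ridem_restr hf) (tot_restr hf).
Proof.
have [[f1 fM] fp f0 fU] := hf; split.
- apply: boolean_hom_of_compl => [b c|||b].
  + by apply: val_inj; exact: fM.
  + by apply: val_inj; exact: f0.
  + by apply: val_inj; exact: f1.
  + set e := _ `|` _.
    have bb' : rdisjoint (\val b) (\val (~` b)).
      by rewrite /rdisjoint !ridemP -ridem_meetE meetxC.
    have := is_join_compl b 1; rewrite !mulg1 => /(fU _ _ _ bb') [_ _].
    move=> /(_ (\val e) (leUl _ _ : ridem_restr hf b <= e)).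
    move=> /(_ (leUr _ _ : ridem_restr hf (~` b) <= e)).
    by rewrite f1 => /rleP; rewrite rplus1 mul1g => e1; apply: val_inj.
- by split=> [|m n]; apply: val_inj; rewrite /= ?f1 ?valM ?fM.
- by move=> b m n; rewrite !tot_caseE /= -!fM => ->.
- by move=> m b; apply: val_inj; rewrite /= -fM fp.
Qed.

Definition down_map (S T : brmon) (f : br_Hom S T) : mp_Hom (down S) (down T) :=
  exist _ (ridem_restr (svalP f), tot_restr (svalP f))
    (down_restr_hom (svalP f)).

Fact down_map1 (S : brmon) : down_map (br_idm S) = mp_idm (down S).
Proof. by apply: mp_Hom_eq => x; apply: val_inj. Qed.

Fact down_mapM (S T U : brmon) (g : br_Hom T U) (f : br_Hom S T) :
  down_map (br_compose g f) = mp_compose (down_map g) (down_map f).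
Proof. by apply: mp_Hom_eq => x; apply: val_inj. Qed.

Definition down_functor : functor brMon matchedPairs :=
  @Functor brMon matchedPairs down down_map down_map1 down_mapM.

(* Main.v *)
From HB Require Import structures.
From mathcomp Require Import all_boot all_order.
From mathcomp Require Import boolp.
Require Import Defs.

Set Implicit Arguments.
Unset Strict Implicit.
Unset Printing Implicit Defensive.

Import Order.Theory.

Local Open Scope group_scope.
Local Open Scope order_scope.

(** Every element of a Boolean restriction monoid factors as [s = s^+ m] with
    [m] total: fill in the part where [s] is undefined by the identity
    ([tot_extend]).  The factor [m] is determined exactly up to [s^+ m = s^+ n],
    which is the relation [m =_(s^+) n] of the matched pair, and the product of
    two elements in this form is again computed in the matched pair:
    [(b m) (c n) = (b /\ m^*c) (m n)].  So a Boolean restriction monoid is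
    recovered from its idempotents and its total elements, and the functor is
    an equivalence because it is fully faithful and essentially surjective
    ([equivalence_of_ff_eso]).

    Faithfulness is the factorization.  For fullness, a homomorphism
    [[phi | g]] is extended by [b m |-> phi(b) g(m)].  That the extension
    preserves joins of disjoint elements comes down to its being monotone and
    to [phi] preserving joins, since an upper bound [u] of [s] and [t] is their
    join precisely when [u^+] is the join of [s^+] and [t^+]
    ([is_join_plusP]).

    For essential surjectivity, a matched pair [[B | M]] gives the Boolean
    restriction monoid of formal products [b m], that is, of pairs [(b, m)] with
    [m] taken modulo [=_b].  In it [b m <= c n] iff [b <= c] and [m =_b n], and
    the join of [b m] and [c n] with [b /\ c = 0] is [(b \/ c) p], where
    [p = b(m, n)] agrees with [m] on [b] and with [n] on [c].  Its idempotents
    are the [b 1] and its total elements are the [1 m], which gives back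
    [[B | M]]. *)

(** * Equivalences of categories *)

(** The quasi-inverse sends [d] to a chosen [c] with [F c] isomorphic to [d],
    and a morphism to the unique preimage under [F] of its conjugate by the
    chosen isomorphisms. *)
Lemma equivalence_of_ff_eso (C D : category) (F : functor C D) :
  (forall x y : C, injective (@fmap C D F x y)) ->
  (forall (x y : C) (k : hom (F x) (F y)), exists h : hom x y, fmap F h = k) ->
  (forall d : D, exists (c : C) (k : hom (F c) d) (l : hom d (F c)),
    compose k l = idm d /\ compose l k = idm (F c)) ->
  is_equivalence F.
Proof.
move=> F_inj F_full F_eso.
pose G0 d := sval (cid (F_eso d)).
have /(_ _)/cid-/all_sig[k kP] d := svalP (cid (F_eso d)).
have /(_ _)/cid-/all_sig[l lP] d := kP d.
have kl d : compose (k d) (l d) = idm d by have [] := lP d.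
have lk d : compose (l d) (k d) = idm (F (G0 d)) by have [] := lP d.
pose lift x y h := sval (cid (F_full x y h)).
have liftK x y h : fmap F (lift x y h) = h by exact: svalP (cid (F_full x y h)).
pose G1 d e (f : hom d e) : hom (G0 d) (G0 e) :=
  lift _ _ (compose (l e) (compose f (k d))).
have FG1 d e (f : hom d e) :
    fmap F (G1 d e f) = compose (l e) (compose f (k d)) by exact: liftK.
have G1_id d : G1 d d (idm d) = idm (G0 d).
  by apply: F_inj; rewrite FG1 fmap1 compose1m lk.
have G1_comp d e f (v : hom e f) (u : hom d e) :
    G1 d f (compose v u) = compose (G1 e f v) (G1 d e u).
  apply: F_inj; rewrite fmapM !FG1 -!composeA; congr (compose _ (compose _ _)).
  by rewrite !composeA kl compose1m.
pose G := @Functor D C G0 G1 G1_id G1_comp.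
exists G; split; constructor.
- apply: (@NatIso _ _ (functor_id C) (functor_comp G F)
    (fun x => lift x (G0 (F x)) (l (F x)))
    (fun x => lift (G0 (F x)) x (k (F x)))).
  + move=> x y f /=; apply: F_inj.
    by rewrite !fmapM FG1 !liftK -!composeA kl composem1.
  + by move=> x /=; apply: F_inj; rewrite !fmapM !liftK kl fmap1.
  + by move=> x /=; apply: F_inj; rewrite !fmapM !liftK lk fmap1.
- apply: (@NatIso _ _ (functor_comp F G) (functor_id D) k l) => //= x y f.
  by rewrite FG1 !composeA kl compose1m.
Qed.

(** * Joins and total extensions in a Boolean restriction monoid *)

Section BooleanRestriction.
Variable S : booleanRestrictionMonoidType.
Implicit Types (b : ridem S) (s t u : S) (m n : tot S).

Lemma rle_of_plus s t : rle s t -> ridem_plus s <= ridem_plus t.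
Proof. by move=> st; rewrite ridem_leE; apply/eqP; exact: rle_plus. Qed.

(** Elements below [u] are the restrictions of [u] to idempotents, so
    whether [u] is the join can be read off the domains.  If [s^+ \/ t^+] missed
    part of the domain of [u], then restricting [u] to [s^+ \/ t^+] would give a
    smaller upper bound; conversely any upper bound [v] agrees with [u] on
    [s^+] and on [t^+], hence on [u^+]. *)
Lemma is_join_plusP s t u : rle s u -> rle t u ->
  is_join s t u <-> ridem_plus u <= ridem_plus s `|` ridem_plus t.
Proof.
move=> su tu; split=> [[_ _ u_min]|].
  set e := _ `|` _.
  have le r : rle r u -> ridem_plus r <= e -> rle r (\val e * u).
    move=> /rleP ru; rewrite ridem_leE => /eqP re.
    by apply/rleP; rewrite mulgA re.
  have := u_min _ (le _ su (leUl _ _)) (le _ tu (leUr _ _)).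
  move=> /rle_of_plus/le_trans; apply.
  have -> : ridem_plus (\val e * u) = e `&` ridem_plus u.
    by apply: val_inj; rewrite -rplus_ridemM.
  exact: leIl.
move=> u_le; split=> // v /rleP sv /rleP tv; apply/rleP.
move/rleP: su => su; move/rleP: tu => tu.
have sub r : rplus r * u = r -> rplus r * v = r ->
    forall c, c `&` ridem_plus u <= ridem_plus r ->
    \val c * (rplus u * v) = \val c * u.
  move=> ru rv c; rewrite ridem_leE => /eqP /= cr.
  rewrite -[u in RHS]mulrplus !mulgA -cr -!mulgA rv.
  by rewrite ru.
(* Off [s^+], the domain of [u] lies in [t^+]. *)
apply: (@ridem_sep _ (ridem_plus s)); first by apply: (sub s) => //; exact: leIl.
by apply: (sub t) => //; rewrite meetC -diffE leBLR.
Qed.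

(** The total extension is the join of [s] with the complement of [s^+], that
    is, with the identity restricted to where [s] is undefined. *)
Lemma tot_extend s : exists m : tot S, rplus s * \val m = s.
Proof.
have disj : rdisjoint s (\val (~` ridem_plus s)).
  by have := ridem_compl_disjoint (ridem_plus s) s 1; rewrite mulg1 /= mulrplus.
have [j [sj s'j _]] := disjoint_join _ _ disj.
have j1 : rplus j == 1.
  have : \top <= ridem_plus j.
    rewrite -(joinxC (ridem_plus s)) leUx.
    rewrite (rle_of_plus sj) /=.
    have -> // : ~` ridem_plus s = ridem_plus (\val (~` ridem_plus s)).
      by apply: val_inj; rewrite /= ridemP.
    exact: rle_of_plus.
  by rewrite ridem_leE ridem_topE mul1g.
by exists (Tot j1); apply/rleP.
Qed.

Definition tot_ext s : tot S := sval (cid (tot_extend s)).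

Lemma tot_extE s : rplus s * \val (tot_ext s) = s.
Proof. by rewrite /tot_ext; case: cid. Qed.

Lemma rplus_ridem_tot b m : rplus (\val b * \val m) = \val b.
Proof. by rewrite rplus_ridemM /= totP mulg1. Qed.

(** The axiom [s t^+ = (st)^+ s] moves the idempotent [c] to the left across
    [m], where it becomes [m^*c]. *)
Lemma mul_ridem_tot b c m n :
  (\val b * \val m) * (\val c * \val n) =
  \val (b `&` tot_act m c) * \val (m * n).
Proof.
rewrite ridem_meetE valM !mulgA -(mulgA (\val b) (\val (tot_act m c))).
by rewrite tot_act_mul !mulgA.
Qed.

End BooleanRestriction.

(** * The functor is fully faithful *)

Lemma down_faithful (S T : brmon) : injective (@fmap _ _ down_functor S T).
Proof.
move=> f g fg; apply: br_Hom_eq => s; rewrite -(tot_extE s).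
have [[_ fM] fp _ _] := svalP f; have [[_ gM] gp _ _] := svalP g.
have e1 : sval f (rplus s) = sval g (rplus s).
  exact: (congr1 (fun h : mp_Hom (down S) (down T) =>
    \val ((sval h).1 (ridem_plus s) : ridem T)) fg).
have e2 : sval f (\val (tot_ext s)) = sval g (\val (tot_ext s)).
  exact: (congr1 (fun h : mp_Hom (down S) (down T) =>
    \val ((sval h).2 (tot_ext s) : tot T)) fg).
by rewrite fM gM e1 e2.
Qed.

Section Extension.
Variables (S T : brmon) (phi : ridem S -> ridem T) (g : tot S -> tot T).
Hypothesis phig : @mp_hom (down S) (down T) phi g.
Implicit Types (b c : ridem S) (m n : tot S) (s t : S).

(** The formula is stated with the chosen total extension of [s]; [br_extE]
    shows that any other choice gives the same value, because [g] preserves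
    the relations [=_b]. *)
Definition br_ext s : T := \val (phi (ridem_plus s)) * \val (g (tot_ext s)).

Lemma br_extE b m : br_ext (\val b * \val m) = \val (phi b) * \val (g m).
Proof.
rewrite /br_ext.
have -> : ridem_plus (\val b * \val m) = b.
  by apply: val_inj; exact: rplus_ridem_tot.
apply/tot_caseE/(mp_hom_equiv phig)/tot_caseE.
by have := tot_extE (\val b * \val m); rewrite rplus_ridem_tot.
Qed.

Lemma br_ext_ridem b : br_ext (\val b) = \val (phi b).
Proof.
have [_ [g1 _] _ _] := phig.
by have := br_extE b 1; rewrite (g1 : g 1 = 1) !val1 !mulg1.
Qed.

Lemma br_ext_tot m : br_ext (\val m) = \val (g m).
Proof.
have [[_ _ _ phi1 _] _ _ _] := phig.
by have := br_extE \top m; rewrite (phi1 : phi \top = \top) !ridem_topE !mul1g.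
Qed.

Lemma br_ext_plus s : br_ext (rplus s) = rplus (br_ext s).
Proof.
by rewrite [in RHS]/br_ext rplus_ridem_tot (br_ext_ridem (ridem_plus s)).
Qed.

Lemma br_extM s t : br_ext (s * t) = br_ext s * br_ext t.
Proof.
have [[phiI _ _ _ _] [_ gM] _ gact] := phig.
rewrite -(tot_extE s) -(tot_extE t).
rewrite (mul_ridem_tot (ridem_plus s) (ridem_plus t)) br_extE.
rewrite (br_extE (ridem_plus s)) (br_extE (ridem_plus t)) mul_ridem_tot.
congr (_ * _); last by congr (\val _); exact: gM.
congr (\val _); rewrite (phiI : {morph phi : x y / x `&` y}); congr (_ `&` _).
exact/esym/gact.
Qed.

Lemma br_ext_hom : br_hom br_ext.
Proof.
have [[_ phiU phi0 phi1 _] _ _ _] := phig.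
have mono s t : rle s t -> rle (br_ext s) (br_ext t).
  by move=> /rleP st; apply/rleP; rewrite -br_ext_plus -br_extM st.
split.
- split; last exact: br_extM.
  by have := br_ext_ridem (ridem1 S); rewrite (phi1 : phi \top = \top).
- exact: br_ext_plus.
- by rewrite br_ext_ridem (phi0 : phi \bot = \bot).
- have plusE s : ridem_plus (br_ext s) = phi (ridem_plus s).
    by apply: val_inj; rewrite /= -br_ext_plus (br_ext_ridem (ridem_plus s)).
  move=> s t u _ stu; have [su tu _] := stu.
  apply/(is_join_plusP (mono _ _ su) (mono _ _ tu)); rewrite !plusE.
  have -> : ridem_plus u = ridem_plus s `|` ridem_plus t.
    apply/le_anti; rewrite leUx (rle_of_plus su) (rle_of_plus tu) !andbT.
    exact/(is_join_plusP su tu).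
  by rewrite (phiU : {morph phi : x y / x `|` y}).
Qed.

End Extension.

Lemma down_full (S T : brMon) (k : hom (down_functor S) (down_functor T)) :
  exists h : hom S T, fmap down_functor h = k.
Proof.
have kP := svalP (k : mp_Hom (down S) (down T)).
exists (exist _ _ (br_ext_hom kP)).
apply: mp_Hom_eq => x; apply: val_inj.
  exact: br_ext_ridem kP x.
exact: br_ext_tot kP x.
Qed.

(** * Equality on a part in a [B]-set *)

Section BSet.
Variables (B : boolAlgType) (X : Type) (op : B -> X -> X -> X).
Hypothesis opP : is_bset op.
Implicit Types (b c : B) (x y z : X).
Local Notation "x =_ b y" := (bset_equiv op b x y)
  (at level 70, b at level 2, format "x  =_ b  y").

Lemma bset_equiv_refl b x : x =_b x. Proof. exact: bset_xx. Qed.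

Lemma bset_equiv_sym b x y : x =_b y -> y =_b x.
Proof. by rewrite /bset_equiv => <-; rewrite (bset_opl opP) (bset_xx opP). Qed.

Lemma bset_equiv_trans b x y z : x =_b y -> y =_b z -> x =_b z.
Proof. by rewrite /bset_equiv => <-; rewrite (bset_opl opP). Qed.

Lemma bset_equiv_le b c x y : c <= b -> x =_b y -> x =_c y.
Proof.
move=> /meet_idPl <-; rewrite /bset_equiv (bset_meet opP) => ->.
exact: bset_xx.
Qed.

(** Expressing the join through complement and meet turns [(b \/ c)(x, y)]
    into [b'(c'(y, x), x)], and [c'(y, x) = c(x, y) = y]. *)
Lemma bset_equivU b c x y : x =_b y -> x =_c y -> x =_(b `|` c) y.
Proof.
rewrite /bset_equiv => xy_b xy_c.
rewrite -[b `|` c]complK complU (bset_compl opP) (bset_meet opP).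
by rewrite !(bset_compl opP) xy_c.
Qed.

Lemma bset_equiv_bot x y : x =_\bot y.
Proof. by rewrite /bset_equiv -compl1 (bset_compl opP) (bset_top opP). Qed.

Lemma bset_equiv_top x y : x =_\top y -> x = y.
Proof. by rewrite /bset_equiv (bset_top opP). Qed.

Lemma bset_op_equivl b x y : op b x y =_b x.
Proof. by rewrite /bset_equiv (bset_opl opP) (bset_xx opP). Qed.

Lemma bset_op_equivr b x y : op b x y =_(~` b) y.
Proof. by rewrite /bset_equiv (bset_compl opP) (bset_opr opP) (bset_xx opP). Qed.

(** This is what produces the joins of disjoint elements: the element pasted
    from [x] on [b] and [y] on the complement of [b] agrees with [y] on every
    [c] disjoint from [b]. *)
Lemma bset_op_disjoint b c : b `&` c = \bot ->
  forall x y, x =_b op b x y /\ y =_c op b x y.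
Proof.
move=> bc0 x y; split; apply: bset_equiv_sym; first exact: bset_op_equivl.
apply: bset_equiv_le (bset_op_equivr b x y).
by rewrite -disj_leC meetC bc0.
Qed.

Lemma bset_equiv_op b x y z : z =_b x -> z =_(~` b) y -> z = op b x y.
Proof.
move=> zx zy; apply: bset_equiv_top; rewrite -(joinxC b); apply: bset_equivU.
  exact: bset_equiv_trans zx (bset_equiv_sym (bset_op_equivl _ _ _)).
exact: bset_equiv_trans zy (bset_equiv_sym (bset_op_equivr _ _ _)).
Qed.

End BSet.

(** * Isomorphisms of matched pairs *)

Lemma boolean_hom_can (B B' : boolAlgType) (f : B -> B') (g : B' -> B) :
  boolean_hom f -> cancel f g -> cancel g f -> boolean_hom g.
Proof.
move=> [fI fU f0 f1 fC] fK gK; split.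
- by move=> x y; apply: (can_inj fK); rewrite fI !gK.
- by move=> x y; apply: (can_inj fK); rewrite fU !gK.
- by apply: (can_inj fK); rewrite f0 gK.
- by apply: (can_inj fK); rewrite f1 gK.
- by move=> x; apply: (can_inj fK); rewrite fC !gK.
Qed.

(** The relations [=_b] determine the operation: [b(m, n)] is the only element
    that agrees with [m] on [b] and with [n] on the complement of [b]. *)
Lemma mp_hom_op (P Q : matched_pair) (phi : mpB P -> mpB Q)
    (f : mpM P -> mpM Q) b m n : mp_hom phi f ->
  f (mp_op b m n) = mp_op (phi b) (f m) (f n).
Proof.
move=> [[_ _ _ _ phiC] _ fe _]; apply: (bset_equiv_op (mp_bset Q)).
  by apply: fe; exact: bset_op_equivl (mp_bset P) _ _ _.
by rewrite -phiC; apply: fe; exact: bset_op_equivr (mp_bset P) _ _ _.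
Qed.

(** The inverse preserves the relations [=_b] because they are equations
    [b(m, n) = n] in an operation that homomorphisms preserve. *)
Lemma mp_hom_can (P Q : matched_pair) (phi : mpB P -> mpB Q)
    (psi : mpB Q -> mpB P) (f : mpM P -> mpM Q) (g : mpM Q -> mpM P) :
  mp_hom phi f -> cancel phi psi -> cancel psi phi -> cancel f g ->
  cancel g f -> mp_hom psi g.
Proof.
move=> phif phiK psiK fK gK; have [phiH [f1 fM] _ fact] := phif; split.
- exact: boolean_hom_can phiK psiK.
- split=> [|m n]; apply: (can_inj fK); first by rewrite f1 gK.
  by rewrite fM !gK.
- move=> b m n mn; rewrite /bset_equiv; apply: (can_inj fK).
  by rewrite (mp_hom_op _ _ _ phif) psiK !gK.
- by move=> m b; apply: (can_inj phiK); rewrite -fact !gK !psiK.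
Qed.

(** * The Boolean restriction monoid of a matched pair *)

(** The pair [(b, m)] stands for the product [b m], for which only the class of
    [m] modulo [=_b] matters.  Each class has the canonical representative
    [b(m, 1)], which agrees with [m] on [b] and with [1] elsewhere, so the
    quotient is realized as the set of pairs whose second component is
    canonical. *)
Record up (P : matched_pair) := Up {
  up_val : mpB P * mpM P;
  _ : mp_op up_val.1 up_val.2 1 == up_val.2
}.
HB.instance Definition _ (P : matched_pair) := [isSub for @up_val P].
HB.instance Definition _ (P : matched_pair) := [Choice of up P by <:].

Section Up.
Variable P : matched_pair.
Implicit Types (b c : mpB P) (m n p : mpM P) (s t u v : up P).
Local Notation "x =_ b y" := (bset_equiv (@mp_op P) b x y)
  (at level 70, b at level 2, format "x  =_ b  y").
Let opP := mp_bset P.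

Fact mk_up_subproof b m :
  mp_op (b, mp_op b m 1).1 (b, mp_op b m 1).2 1 == (b, mp_op b m 1).2.
Proof. by rewrite /= (bset_opl opP). Qed.

Definition mk_up b m : up P := Up (mk_up_subproof b m).

Lemma up_mk s : s = mk_up (\val s).1 (\val s).2.
Proof.
by apply: val_inj; case: s => -[b m] /= /eqP ->.
Qed.

(** All later equalities and inequalities are decided by this criterion, so
    that the canonical representatives need not be computed. *)
Lemma mk_upP b c m n : mk_up b m = mk_up c n <-> b = c /\ m =_b n.
Proof.
split=> [/(congr1 val)[<- mn]|[<- mn]].
  split=> //; apply: (bset_equiv_trans opP) (bset_op_equivl opP _ _ 1).
  rewrite -mn; exact: bset_equiv_sym (bset_op_equivl opP _ _ _).
apply: val_inj; congr (_, _) => /=.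
by rewrite -(bset_opl opP _ m n) mn.
Qed.

Lemma up_val_mk b m : (\val (mk_up b m)).2 =_b m.
Proof. exact: bset_op_equivl. Qed.

Definition up_mul s t : up P :=
  mk_up ((\val s).1 `&` mp_act (\val s).2 (\val t).1) ((\val s).2 * (\val t).2).
Definition up_one : up P := mk_up \top 1.
Definition up_plus s : up P := mk_up (\val s).1 1.

(** The product respects representatives: [m =_b m'] gives [mn =_b m'n] and
    [b /\ m^*c = b /\ m'^*c], while [n =_c n'] gives [mn =_(m^*c) mn']; both
    relations hold on [b /\ m^*c]. *)
Lemma up_mulE b c m n :
  up_mul (mk_up b m) (mk_up c n) = mk_up (b `&` mp_act m c) (m * n).
Proof.
have actE := mp_equiv_act c (up_val_mk b m).
apply/mk_upP; split=> //; rewrite actE.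
apply: (bset_equiv_trans opP).
  apply: bset_equiv_le (leIl _ _) _ => //.
  exact: mp_equiv_mulr (up_val_mk b m).
apply: bset_equiv_le (leIr _ _) _ => //.
exact: mp_equiv_mull (up_val_mk c n).
Qed.

Lemma act_meet m b c : mp_act m (b `&` c) = mp_act m b `&` mp_act m c.
Proof. by case: (mp_act_hom m) => ->. Qed.
Lemma act_join m b c : mp_act m (b `|` c) = mp_act m b `|` mp_act m c.
Proof. by case: (mp_act_hom m) => _ ->. Qed.
Lemma act_top m : mp_act m \top = \top :> mpB P.
Proof. by case: (mp_act_hom m). Qed.
Lemma act_bot m : mp_act m \bot = \bot :> mpB P.
Proof. by case: (mp_act_hom m). Qed.

Fact up_mulA : associative up_mul.
Proof.
move=> s t u; rewrite (up_mk s) (up_mk t) (up_mk u) !up_mulE.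
by rewrite act_meet meetA mp_actM mulgA.
Qed.

Fact up_mul1s : left_id up_one up_mul.
Proof. by move=> s; rewrite (up_mk s) up_mulE mp_act1 meet1x mul1g. Qed.

Fact up_muls1 : right_id up_one up_mul.
Proof. by move=> s; rewrite (up_mk s) up_mulE act_top meetx1 mulg1. Qed.

HB.instance Definition _ := isMonoid.Build (up P) up_mulA up_mul1s up_muls1.

Lemma mk_upM b c m n : mk_up b m * mk_up c n = mk_up (b `&` mp_act m c) (m * n).
Proof. exact: up_mulE. Qed.

Lemma mk_up1M b c n : mk_up b 1 * mk_up c n = mk_up (b `&` c) n.
Proof. by rewrite mk_upM mp_act1 mul1g. Qed.

Fact up_mulplus s : up_plus s * s = s.
Proof. by rewrite (up_mk s) mk_up1M meetxx. Qed.

Fact up_plusM s t : up_plus (up_plus s * t) = up_plus s * up_plus t.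
Proof. by rewrite (up_mk t) mk_up1M [in RHS]mk_up1M. Qed.

Fact up_plusC s t : up_plus s * up_plus t = up_plus t * up_plus s.
Proof. by rewrite !mk_up1M meetC. Qed.

Fact up_mul_plus s t : s * up_plus t = up_plus (s * t) * s.
Proof.
rewrite (up_mk s) (up_mk t) !mk_upM mulg1 mp_act1 mul1g.
by rewrite [in RHS]meetC meetA meetxx.
Qed.

HB.instance Definition _ :=
  Monoid_isRestriction.Build (up P) up_mulplus up_plusM up_plusC up_mul_plus.

Lemma rplus_mk b m : rplus (mk_up b m) = mk_up b 1.
Proof. by []. Qed.

Lemma mk_up_leP b c m n : rle (mk_up b m) (mk_up c n) <-> b <= c /\ m =_b n.
Proof.
have -> : rle (mk_up b m) (mk_up c n) <-> mk_up (b `&` c) n = mk_up b m.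
  by rewrite -mk_up1M; split=> [/rleP|?]; last apply/rleP.
rewrite mk_upP; split=> -[bc mn].
  by split; [exact/meet_idPl|rewrite bc in mn; exact: bset_equiv_sym].
by rewrite (meet_idPl bc); split=> //; exact: bset_equiv_sym.
Qed.

Fact mk_up_ridem b : rplus (mk_up b 1) == mk_up b 1.
Proof. by []. Qed.

Definition up_ridem b : ridem (up P) := RIdem (mk_up_ridem b).
Definition up_ridem_inv (r : ridem (up P)) : mpB P := (\val (\val r)).1.

Lemma up_ridemK : cancel up_ridem up_ridem_inv.
Proof. by []. Qed.

Lemma up_ridem_invK : cancel up_ridem_inv up_ridem.
Proof. by move=> r; apply: val_inj; exact: ridemP r. Qed.

Fact up_ridem_boolean : boolean_poset (ridem (up P)).
Proof.
exists (mpB P), up_ridem_inv; split.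
  by exists up_ridem; [exact: up_ridem_invK|exact: up_ridemK].
move=> r s; rewrite -(up_ridem_invK r) -(up_ridem_invK s) !up_ridemK.
apply/idP/idP => [bc|/mk_up_leP[]//].
by apply/mk_up_leP; split=> //; exact: bset_equiv_refl.
Qed.

Lemma mk_up_bot m n : mk_up \bot m = mk_up \bot n.
Proof. by apply/mk_upP; split=> //; exact: bset_equiv_bot. Qed.

Fact up_zero_rle s : rle (\val (up_ridem \bot)) s.
Proof.
by rewrite (up_mk s); apply/mk_up_leP; rewrite le0x; split=> //;
  exact: bset_equiv_bot.
Qed.

Lemma mk_up_join b c m n p : m =_b p -> n =_c p ->
  is_join (mk_up b m) (mk_up c n) (mk_up (b `|` c) p).
Proof.
move=> mp np; split; [| |move=> v; rewrite (up_mk v)].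
- by apply/mk_up_leP; rewrite leUl.
- by apply/mk_up_leP; rewrite leUr.
move=> /mk_up_leP[bv mv] /mk_up_leP[cv nv]; apply/mk_up_leP; split.
  by rewrite leUx bv cv.
apply: bset_equivU => //.
  exact: bset_equiv_trans (bset_equiv_sym opP mp) mv.
exact: bset_equiv_trans (bset_equiv_sym opP np) nv.
Qed.

Lemma mk_up_disjointP b c m n :
  rplus (mk_up b m) * rplus (mk_up c n) = mk_up \bot 1 <-> b `&` c = \bot.
Proof.
rewrite !rplus_mk mk_up1M mk_upP; split=> [[]//|->].
by split=> //; exact: bset_equiv_refl.
Qed.

Fact up_disjoint_join s t :
  rplus s * rplus t = \val (up_ridem \bot) -> exists u, is_join s t u.
Proof.
rewrite (up_mk s) (up_mk t).
move=> /mk_up_disjointP/(bset_op_disjoint opP)/(_ (\val s).2 (\val t).2)[sp tp].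
by eexists; exact: mk_up_join sp tp.
Qed.

Fact up_mul_zero s : s * \val (up_ridem \bot) = \val (up_ridem \bot).
Proof.
by rewrite (up_mk s) mk_upM act_bot meetx0; exact: mk_up_bot.
Qed.

(** By uniqueness of joins, [v] is the explicit join [(b \/ c) p] of [t = b m]
    and [u = c n]; multiplying by [s = d q] gives [(d /\ q^*(b \/ c)) (q p)],
    and [q^*] preserves joins. *)
Fact up_mul_join s t u v : rplus t * rplus u = \val (up_ridem \bot) ->
  is_join t u v -> is_join (s * t) (s * u) (s * v).
Proof.
rewrite (up_mk s) (up_mk t) (up_mk u).
move=> /mk_up_disjointP/(bset_op_disjoint opP)/(_ (\val t).2 (\val u).2)[tp up].
have [tj uj j_min] := mk_up_join tp up; move=> [tv uv v_min].
rewrite (rle_anti (v_min _ tj uj) (j_min _ tv uv)) !mk_upM act_join meetUr.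
apply: mk_up_join; (apply: bset_equiv_le (leIr _ _) _ => //);
  exact: mp_equiv_mull.
Qed.

HB.instance Definition _ := RestrictionMonoid_isBoolean.Build (up P)
  up_ridem_boolean up_zero_rle up_disjoint_join up_mul_zero up_mul_join.

Fact up_nondeg : \val (rzero : ridem (up P)) <> 1.
Proof. by move=> /mk_upP[/(@mp_nondeg P)]. Qed.

Definition up_brmon : brmon := BRMon up_nondeg.

Lemma mk_up_tot m : rplus (mk_up \top m) == 1.
Proof. by []. Qed.

Definition up_tot m : tot (up P) := Tot (mk_up_tot m).
Definition up_tot_inv (r : tot (up P)) : mpM P := (\val (\val r)).2.

Lemma up_totK : cancel up_tot up_tot_inv.
Proof. by move=> m; exact: (bset_top opP). Qed.

Lemma up_tot_invK : cancel up_tot_inv up_tot.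
Proof.
move=> r; apply: val_inj; rewrite [RHS]up_mk /up_tot_inv /=; congr (mk_up _ _).
by have /mk_upP[] := totP r.
Qed.

Lemma mk_up_ridem_tot b m :
  \val (up_ridem b) * \val (up_tot m) = mk_up b m.
Proof. by rewrite mk_up1M meetx1. Qed.

Lemma up_ridem_hom : boolean_hom up_ridem.
Proof.
apply: boolean_hom_of_compl => [b c|||b].
- by apply: val_inj; rewrite ridem_meetE /= mk_up1M.
- by [].
- exact: val_inj.
- apply/le_anti; rewrite lex1 /=; set e := _ `|` _.
  have le c : up_ridem c <= e -> c <= up_ridem_inv e.
    by rewrite -{1}(up_ridem_invK e) => /mk_up_leP[].
  rewrite -(up_ridem_invK e); apply/mk_up_leP; split.
    by rewrite -(joinxC b) leUx !le ?leUl ?leUr.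
  exact: bset_equiv_refl.
Qed.

(** Since [b 1 * 1 m = b m], the relation [m =_b n] holds in [P] exactly when
    [b 1 * 1 m = b 1 * 1 n], which is how the relations of the restriction
    monoid are defined. *)
Lemma up_unit_hom : @mp_hom P (down up_brmon) up_ridem up_tot.
Proof.
split.
- exact: up_ridem_hom.
- split; first exact: val_inj.
  by move=> m n; apply: val_inj; rewrite valM /= mk_upM act_top meetxx.
- move=> b m n mn; apply/tot_caseE; rewrite !mk_up_ridem_tot.
  exact/mk_upP.
- move=> m b; apply: val_inj => /=.
  by rewrite mk_upM meet1x.
Qed.

End Up.

Lemma down_eso (P : matchedPairs) :
  exists (S : brMon) (k : hom (down_functor S) P) (l : hom P (down_functor S)),
    compose k l = idm P /\ compose l k = idm (down_functor S).
Proof.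
have upH := up_unit_hom P.
have upH' := mp_hom_can upH (@up_ridemK P) (@up_ridem_invK P) (@up_totK P)
  (@up_tot_invK P).
exists (up_brmon P), (exist _ (_, _) upH'), (exist _ (_, _) upH).
split; apply: mp_Hom_eq => x.
- exact: up_ridemK.
- exact: up_totK.
- exact: up_ridem_invK.
- exact: up_tot_invK.
Qed.

Theorem theorem3p5 : is_equivalence down_functor.
Proof.
apply: equivalence_of_ff_eso.
- exact: down_faithful.
- exact: down_full.
- exact: down_eso.
Qed.
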